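(* Let $n\ge 2$. Given any $C^2$ function $\varphi:(0,\infty)\to\mathbb{R}$ satisfying $$\lim_{s\to\infty}\varphi(s)=\infty,\qquad \lim_{s\to\infty}\varphi'(s)=0,\qquad \lim_{s\to\infty}\varphi''(s)=0,$$ there is a compactly supported function $u:\mathbb{R}^n\to\mathbb{R}$, depending on $\varphi$, such that $u$ is twice differentiable everywhere in $\mathbb{R}^n$, its Laplacian $\Delta u$ is continuous on $\mathbb{R}^n$, its Hessian $D^2u$ is bounded on $\mathbb{R}^n$, but $u\notin C^2(\mathbb{R}^n)$.
   Context: Bounded Hessian means that all second order partial derivatives of $u$ are bounded functions on $\mathbb{R}^n$. *)

(* Defs.v *)
From HB Require Import structures.
From mathcomp Require Export all_boot all_order all_algebra.
From mathcomp Require Export all_classical all_reals all_analysis.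
Export Order.TTheory GRing.Theory Num.Theory.
Export numFieldNormedType.Exports.

Set Implicit Arguments.
Unset Strict Implicit.
Unset Printing Implicit Defensive.

Local Open Scope ring_scope.
Local Open Scope classical_set_scope.

(* R^n is ['rV[R]_n]. Its library norm is the sup norm, which induces the usual
   topology and hence the same continuity, compactness, boundedness and
   (Frechet) differentiability as the Euclidean norm. *)

Section RealFunctionsOnRn.
Context {R : realType} {n : nat}.
Implicit Types u : 'rV[R]_n -> R.

Definition partial (i : 'I_n) u : 'rV[R]_n -> R := 'D_(delta_mx 0 i) u.

Definition gradient u (x : 'rV[R]_n) : 'rV[R]_n := \row_i partial i u x.

Definition hessian u (x : 'rV[R]_n) : 'M[R]_n :=
  \matrix_(i, j) partial j (partial i u) x.

Definition laplacian u (x : 'rV[R]_n) : R :=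
  \sum_(i < n) partial i (partial i u) x.

(* ['D_v u x] is a junk value where the derivative does not exist, so the
   existence of the partial derivatives is required explicitly. *)
Fixpoint class_C (k : nat) u : Prop :=
  continuous u /\
  if k is k'.+1 then
    forall i : 'I_n, (forall x, derivable u x (delta_mx 0 i)) /\
                     class_C k' (partial i u)
  else True.

Definition twice_differentiable u : Prop :=
  (forall x, differentiable u x) /\ (forall x, differentiable (gradient u) x).

Definition bounded_hessian u : Prop :=
  forall i j : 'I_n, bounded_fun (fun x => hessian u x i j).

Definition compactly_supported u : Prop :=
  compact (closure [set x | u x != 0]).

End RealFunctionsOnRn.

(* A function on (0, oo) is represented by a total function on R; since (0, oo)
   is open, nothing below depends on its values outside (0, oo). *)
Definition class_C2_pos (R : realType) (phi : R -> R) : Prop :=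
  forall s : R, 0 < s ->
    [/\ derivable phi s 1, derivable phi^`() s 1 & {for s, continuous phi^`(2)}].

(* Main.v *)
From mathcomp Require Import ring lra.
Require Import Defs.

(** The function is a sum of disjoint bumps that shrink towards the origin.

    The bumps exploit that the Laplacian does not control the Hessian in the
    sup norm. Let v (here [seed]) be C^2, supported in the unit cube, and equal
    to the harmonic polynomial x_i0 * x_i1 on the half-size cube. The functions
    4^-(2l) v(4^l x) all have the same mixed derivative 1 at 0, so in the sum
    of the first m of them (here [stack] m) that derivative adds up to m. Their
    Laplacians, however, live on the shells 1/2 < 4^l |x| < 1, which are
    pairwise disjoint, so the Laplacian of the sum stays bounded independently
    of m ([partial2_stack0], [laplacian_stack_bounded]). Dividing by m gives
    functions with bounded Hessian, mixed derivative 1 at 0, and a Laplacian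
    of size 1/m.

    Put such a function with m = 2^k, rescaled without changing its second
    derivatives, in the cube of radius r_k = 4^-k / 4 about the point
    y_k = 2^-k e_i0 (here [patch] k). These cubes are disjoint, and they are
    so small that r_k <= |x|^2 on the k-th one. Hence the sum u of all patches
    ([patch_series]) satisfies ([patch_series_bounds])

      |u| <= K |x|^2,  |D u| <= K |x|^2,  |D^2 u| <= K,  |Delta u| <= K |x|.

    Away from the origin u is locally a finite sum of C^2 functions. At the
    origin the first two bounds make u and its gradient differentiable with
    derivative 0, and the last one makes the Laplacian continuous. But the
    mixed second derivative is 1 at every y_k and 0 at the limit 0 of the y_k,
    so it is not continuous. *)

Set Implicit Arguments.
Unset Strict Implicit.
Unset Printing Implicit Defensive.

Local Open Scope ring_scope.
Local Open Scope classical_set_scope.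

(** * Local criteria for differentiability and continuity *)

(** A quadratic error is o(h). It serves twice: for the square of the positive
    part, and, with L = 0, for the final function at the origin. *)
Lemma is_diff_quadratic (R : realType) (V : normedModType R) (f : V -> R)
    (L : {linear V -> R}) (x : V) (C : R) :
  continuous L ->
  (forall h, `|f (h + x) - f x - L h| <= C * `|h| ^+ 2) -> is_diff x f L.
Proof.
move=> cL fL.
have dL : f \o shift x = cst (f x) + L +o_ 0 id.
  apply/eqaddoP => _/posnumP[e].
  have C0 : 0 < `|C| + 1 by rewrite ltr_wpDl.
  have eC : 0 < e%:num / (`|C| + 1) by rewrite divr_gt0.
  apply: (filterS _ (@nbhs0_le _ V _ eC)) => h /=.
  rewrite ler_pdivlMr // => hC.
  rewrite [X in `|X|](_ : _ = f (h + x) - f x - L h); last first.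
    by rewrite -addrA -opprD.
  apply: le_trans (fL h) _; rewrite expr2 mulrA ler_wpM2r //.
  apply: le_trans hC; rewrite mulrC ler_wpM2l //.
  by rewrite (le_trans (ler_norm _)) // lerDl.
have dE := diff_unique cL dL.
by apply: DiffDef => //; apply/diff_locallyP; rewrite dE.
Qed.

Lemma is_diff0_quadratic (R : realType) (V : normedModType R) (f : V -> R)
    (K : R) : f 0 = 0 -> (forall x, `|f x| <= K * `|x| ^+ 2) ->
  is_diff 0 f (\0 : V -> R).
Proof.
move=> f0 fK; apply: (@is_diff_quadratic _ _ _ (\0 : {linear V -> R}) 0 K).
  exact: cst_continuous.
by move=> h; rewrite /= addr0 f0 !subr0.
Qed.

Section NearEquality.
Context {R : realType} {V : normedModType R}.

Lemma near_eq_differentiable (f g : V -> R) (x : V) :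
  {near x, f =1 g} -> differentiable f x -> differentiable g x.
Proof.
move=> fg df; have [cdf /eqaddoP fo] := (diff_locallyP _ _).1 df.
have fgx : f x = g x := nbhs_singleton fg.
have go : g \o shift x = cst (g x) + 'd f x +o_ 0 id.
  apply/eqaddoP => e e0; have near_fg := (nbhs0P _ _).1 fg.
  have near_f : \forall h \near (0 : V),
      `|(f \o shift x - (cst (f x) + 'd f x)) h| <= e * `|h| by exact: fo.
  suff : \forall h \near (0 : V),
      `|(g \o shift x - (cst (g x) + 'd f x)) h| <= e * `|h| by [].
  apply: filterS2 near_fg near_f => h /= fgh.
  by rewrite !fctE /= fgx ![h + x]addrC fgh.
by apply/diff_locallyP; rewrite (diff_unique cdf go).
Qed.

Lemma near_eq_continuous (f g : V -> R) (x : V) :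
  {near x, f =1 g} -> {for x, continuous f} -> {for x, continuous g}.
Proof.
move=> fg; have fgx : f x = g x := nbhs_singleton fg.
rewrite /prop_for /continuous_at -fgx => cf.
by apply: cvg_trans cf; apply: near_eq_cvg; apply: filterS fg => z ->.
Qed.

Lemma continuous0_linear (f : V -> R) (K : R) : f 0 = 0 ->
  (forall h, `|f h| <= K * `|h|) -> {for 0, continuous f}.
Proof.
move=> f0 fK; apply/cvgrPdist_le => e e0; rewrite f0.
have K0 : 0 < `|K| + 1 by rewrite ltr_wpDl.
have eK : 0 < e / (`|K| + 1) by rewrite divr_gt0.
apply: filterS (nbhs0_le eK) => h; rewrite ler_pdivlMr // mulrC => hK.
rewrite sub0r normrN; apply: le_trans (fK h) (le_trans _ hK).
by rewrite ler_wpM2r // (le_trans (ler_norm _)) // lerDl.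
Qed.

End NearEquality.

(** * A twice continuously differentiable cutoff on the line *)

Section Cutoff.
Context {R : realType}.
Implicit Types t y : R.

Definition pos y : R := Num.max y 0.

Lemma pos_ge0 y : 0 <= pos y.
Proof. by rewrite /pos le_max lexx orbT. Qed.

Lemma pos_eq0 y : y <= 0 -> pos y = 0.
Proof. exact: max_r. Qed.

Lemma pos_continuous : continuous pos.
Proof. by move=> y; apply: continuous_max; [exact: cvg_id|exact: cvg_cst]. Qed.

Lemma is_derive_pos2 y : is_derive y 1 (fun z => pos z ^+ 2) (2 * pos y).
Proof.
pose L : {linear R -> R} := *:%R (2 * pos y).
have dL : is_diff y (fun z => pos z ^+ 2) L.
  apply: (@is_diff_quadratic _ _ _ _ _ 1) => [|h].
    exact: scaler_continuous.
  rewrite /L /= /GRing.scale /= mul1r -normrX /pos.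
  rewrite [in leRHS]ger0_norm ?sqr_ge0 // ler_norml.
  by case: (leP y 0) => y0; case: (leP (h + y) 0) => hy0; nra.
apply: DeriveDef; first exact: diff_derivable.
by rewrite deriveE // (@diff_val _ _ _ _ _ _ _ dL); exact: mulr1.
Qed.

Lemma is_derive_pos3 y : is_derive y 1 (fun z => pos z ^+ 3) (3 * pos y ^+ 2).
Proof.
have -> : (fun z => pos z ^+ 3) = id * (fun z => pos z ^+ 2) :> (R -> R).
  apply/funext => z /=; rewrite fctE /pos.
  by case: (leP z 0) => _; rewrite ?expr0n ?mulr0// -exprS.
have H := is_derive_pos2 y.
apply: is_derive_eq; rewrite /GRing.scale /= mulr1.
by rewrite /pos; case: (leP y 0) => _; ring.
Qed.

(** The cubes of positive parts make this C^2; it is 1 for |t| <= 1/2 and at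
    most 0 for |t| >= 1, where the positive part taken in [bump] removes it.
    The suffixes 1 and 2 stand for the first and second derivatives, kept as
    closed formulas so that their vanishing can be read off on the closed sets
    |t| <= 1/2 and |t| >= 1. *)
Definition dip t : R := 1 - pos (4 * t ^+ 2 - 1) ^+ 3.
Definition dip1 t : R := - (24 * t * pos (4 * t ^+ 2 - 1) ^+ 2).
Definition dip2 t : R :=
  - (24 * pos (4 * t ^+ 2 - 1) ^+ 2 + 384 * t ^+ 2 * pos (4 * t ^+ 2 - 1)).

Lemma is_derive_parabola t : is_derive t 1 (fun z => 4 * z ^+ 2 - 1) (8 * t).
Proof.
have -> : (fun z => 4 * z ^+ 2 - 1) = 4 *: (@id R ^+ 2) - cst 1.
  by apply/funext => z; rewrite !fctE.
by apply: is_derive_eq; rewrite /GRing.scale /=; ring.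
Qed.

Lemma is_derive_dip t : is_derive t 1 dip (dip1 t).
Proof.
have -> : dip =
    cst 1 - (fun z => pos z ^+ 3) \o (fun z => 4 * z ^+ 2 - 1) by [].
have H := is_derive_parabola t.
have H' := is_derive_pos3 (4 * t ^+ 2 - 1).
have H2 := @is_derive1_comp _ (fun z => pos z ^+ 3)
  (fun z => 4 * z ^+ 2 - 1) t _ _ H' H.
by apply: is_derive_eq; rewrite /dip1; ring.
Qed.

Lemma is_derive_dip1 t : is_derive t 1 dip1 (dip2 t).
Proof.
have -> : dip1 = - (24 *: (@id R) *
    ((fun z => pos z ^+ 2) \o (fun z => 4 * z ^+ 2 - 1))) by [].
have H := is_derive_parabola t.
have H' := is_derive_pos2 (4 * t ^+ 2 - 1).
have H2 := @is_derive1_comp _ (fun z => pos z ^+ 2)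
  (fun z => 4 * z ^+ 2 - 1) t _ _ H' H.
apply: is_derive_eq; rewrite /dip2 /GRing.scale /=.
rewrite ?fctE /GRing.scale /=; ring.
Qed.

Definition bump t : R := pos (dip t) ^+ 3.
Definition bump1 t : R := 3 * pos (dip t) ^+ 2 * dip1 t.
Definition bump2 t : R :=
  6 * pos (dip t) * dip1 t ^+ 2 + 3 * pos (dip t) ^+ 2 * dip2 t.

Lemma is_derive_bump t : is_derive t 1 bump (bump1 t).
Proof.
exact: (@is_derive1_comp _ (fun z => pos z ^+ 3) dip t _ _
  (is_derive_pos3 (dip t)) (is_derive_dip t)).
Qed.

Lemma is_derive_bump1 t : is_derive t 1 bump1 (bump2 t).
Proof.
have -> : bump1 = (3 *: ((fun z => pos z ^+ 2) \o dip)) * dip1 by [].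
have H := @is_derive1_comp _ (fun z => pos z ^+ 2) dip t _ _
  (is_derive_pos2 (dip t)) (is_derive_dip t).
have H1 := is_derive_dip1 t.
apply: is_derive_eq; rewrite /bump2 /GRing.scale /=.
rewrite ?fctE /GRing.scale /=; ring.
Qed.

Lemma derive_continuous (f f' : R -> R) :
  (forall t, is_derive t 1 f (f' t)) -> continuous f.
Proof.
move=> ff' t; have [dt _] := ff' t.
exact/differentiable_continuous/derivable1_diffP.
Qed.

Lemma bump2_continuous : continuous bump2.
Proof.
have c1 := derive_continuous is_derive_dip.
have c2 := derive_continuous is_derive_dip1.
have cs := derive_continuous is_derive_parabola.
have cp2 := derive_continuous is_derive_pos2.
have cid2 : continuous (fun t : R => t ^+ 2) by exact: exprn_continuous.
have cc (g f : R -> R) : continuous g -> continuous f -> continuous (g \o f).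
  by move=> cg cf t; apply: continuous_comp; [exact: cf|exact: cg].
have cM (g f : R -> R) : continuous g -> continuous f -> continuous (g \* f).
  by move=> cg cf t; apply: continuousM; [exact: cg|exact: cf].
have cD (g f : R -> R) : continuous g -> continuous f -> continuous (g \+ f).
  by move=> cg cf t; apply: continuousD; [exact: cg|exact: cf].
have ck (k : R) : continuous (cst k : R -> R) by exact: cst_continuous.
have c3 : continuous dip2.
  have c4 : continuous (fun t => 24 * pos (4 * t ^+ 2 - 1) ^+ 2 +
      384 * t ^+ 2 * pos (4 * t ^+ 2 - 1)).
    apply: (cD (fun t => 24 * pos (4 * t ^+ 2 - 1) ^+ 2)).
      apply: (cM (cst 24)) => //.
      exact: (cc (fun z => pos z ^+ 2) (fun t => 4 * t ^+ 2 - 1)).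
    apply: (cM (fun t => 384 * t ^+ 2)); first exact: (cM (cst 384)).
    by apply: (cc pos (fun t => 4 * t ^+ 2 - 1)) => //; exact: pos_continuous.
  by move=> t; exact: (cvgN (c4 t)).
apply: (cD (fun t => 6 * pos (dip t) * dip1 t ^+ 2)).
  apply: (cM (fun t => 6 * pos (dip t)) (fun t => dip1 t ^+ 2)).
    apply: (cM (cst 6) (pos \o dip)) => //.
    by apply: cc => //; exact: pos_continuous.
  exact: (cc (fun z => z ^+ 2) dip1).
apply: (cM (fun t => 3 * pos (dip t) ^+ 2)) => //.
by apply: (cM (cst 3)) => //; exact: (cc (fun z => pos z ^+ 2) dip).
Qed.

Lemma dip_inner t : `|t| <= 2^-1 ->
  [/\ dip t = 1, dip1 t = 0 & dip2 t = 0].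
Proof.
move=> t2; have s0 : 4 * t ^+ 2 - 1 <= 0.
  by move: t2; rewrite ler_norml => /andP[]; nra.
by rewrite /dip /dip1 /dip2 pos_eq0 //; split; ring.
Qed.

Lemma pos_dip_outer t : 1 <= `|t| -> pos (dip t) = 0.
Proof.
move=> t1; apply: pos_eq0; rewrite /dip subr_le0 -(expr1n _ 3).
rewrite lerXn2r ?nnegrE ?pos_ge0 // /pos le_max; apply/orP; left.
have : 1 <= t ^+ 2 by rewrite -real_normK ?num_real // expr_ge1.
by lra.
Qed.

(** For m <= 2 this is the m-th derivative of the bump (b false) or of t times
    the bump (b true). Larger m repeat the second derivative, so that bounds
    and vanishing hold for every m. *)
Definition profile (b : bool) (m : nat) t : R :=
  match b, m with
  | false, 0 => bump t
  | false, 1 => bump1 t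
  | false, _ => bump2 t
  | true, 0 => t * bump t
  | true, 1 => bump t + t * bump1 t
  | true, _ => 2 * bump1 t + t * bump2 t
  end.

Lemma is_derive_profile b m t : (m < 2)%N ->
  is_derive t 1 (profile b m) (profile b m.+1 t).
Proof.
have H := is_derive_bump t; have H1 := is_derive_bump1 t.
case: b; case: m => [|[|//]] _ /=.
- have -> : profile true 0 = id * bump by [].
  by apply: is_derive_eq; rewrite /GRing.scale /=; ring.
- have -> : profile true 1 = bump + id * bump1 by [].
  by apply: is_derive_eq; rewrite /GRing.scale /=; ring.
- exact: H.
- exact: H1.
Qed.

Lemma profile_continuous b m : continuous (profile b m).
Proof.
have [m2|m2] := ltnP m 2; first by
  apply: derive_continuous => t; exact: is_derive_profile.
have -> : profile b m = profile b 2 by case: b; case: m m2 => [|[|m]].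
case: b => /=; last exact: bump2_continuous.
move=> t; apply: (@continuousD _ _ _ (fun t => 2 * bump1 t)).
  apply: (@continuousM _ _ (cst 2)); first exact: cst_continuous.
  exact: (derive_continuous is_derive_bump1).
by apply: (@continuousM _ _ id); [exact: cvg_id|exact: bump2_continuous].
Qed.

Lemma profile_outer b m t : 1 <= `|t| -> profile b m t = 0.
Proof.
move=> /pos_dip_outer pt.
have [b0 b1 b2] : [/\ bump t = 0, bump1 t = 0 & bump2 t = 0].
  by rewrite /bump /bump1 /bump2 pt; split; ring.
by case: b; case: m => [|[|m]] /=; rewrite ?b0 ?b1 ?b2 ?mulr0 ?addr0.
Qed.

Lemma profile_inner b m t : `|t| <= 2^-1 ->
  profile b m t = match b, m with
    | false, 0 => 1 | true, 0 => t | true, 1 => 1 | _, _ => 0 end.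
Proof.
move=> /dip_inner[d0 d1 d2].
have p1 : pos 1 = 1 :> R by rewrite /pos max_l.
have [b0 b1 b2] : [/\ bump t = 1, bump1 t = 0 & bump2 t = 0].
  by rewrite /bump /bump1 /bump2 d0 d1 d2 p1; split; ring.
by case: b; case: m => [|[|m]] /=; rewrite ?b0 ?b1 ?b2 ?mulr0 ?addr0 ?mulr1.
Qed.

Lemma profile_bounded : exists2 B, 0 <= B & forall b m t, `|profile b m t| <= B.
Proof.
have bd b m : exists B, forall t, `|profile b m t| <= B.
  have : compact (profile b m @` `[-1, 1]).
    apply: continuous_compact; last exact: segment_compact.
    by apply: continuous_subspaceT; exact: profile_continuous.
  move=> /compact_bounded[M [_ HM]]; exists (Num.max (M + 1) 0) => t.
  have [t1|t1] := leP 1 `|t|.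
    by rewrite profile_outer // normr0 le_max lexx orbT.
  rewrite le_max (HM (M + 1)) ?ltrDl //; exists t => //=.
  by rewrite in_itv /= -ler_norml ltW.
have bd2 b : exists B, forall m t, `|profile b m t| <= B.
  have [B0 H0] := bd b 0; have [B1 H1] := bd b 1; have [B2 H2] := bd b 2.
  exists (Num.max B0 (Num.max B1 B2)) => m t.
  rewrite !le_max; case: m => [|[|m]]; rewrite ?H0 ?H1 ?orbT //.
  by rewrite (_ : profile b m.+2 = profile b 2) ?H2 ?orbT //; case: b.
have [Bt Ht] := bd2 true; have [Bf Hf] := bd2 false.
exists (Num.max 0 (Num.max Bt Bf)); first by rewrite le_max lexx.
by move=> [] m t; rewrite !le_max ?Ht ?Hf !orbT.
Qed.

End Cutoff.

(** * Calculus of first and second partial derivatives *)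

Section SecondOrder.
Context {R : realType} {n : nat}.
Implicit Types (u w : 'rV[R]_n -> R) (x y : 'rV[R]_n) (a c : R).

Lemma coord_le_norm x i : `|x 0 i| <= `|x|.
Proof.
rewrite [leRHS]/Num.Def.normr /= mx_normrE.
exact: (le_bigmax _ (fun ij : 'I_1 * 'I_n => `|x ij.1 ij.2|) (0, i)).
Qed.

Lemma ex_coord_norm x : 0 < `|x| -> exists i, `|x| = `|x 0 i|.
Proof.
move=> /lt0r_neq0 /mx_norm_neq0[[i j] /= xij]; exists j.
by rewrite /Num.Def.normr /= [in LHS]xij /= ord1.
Qed.

(** Frechet differentiability is part of the predicate: it is what the calculus
    of directional derivatives needs, and what is inherited by the final
    function away from the origin. *)
Definition C2_everywhere u : Prop :=
  [/\ forall x, differentiable u x,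
      forall i x, differentiable (partial i u) x
    & forall i j, continuous (partial j (partial i u))].

Lemma partial_cst0 i : partial i (cst 0 : 'rV[R]_n -> R) = cst 0.
Proof. by apply/funext => x; rewrite /partial derive_cst. Qed.

Lemma C2_cst0 : C2_everywhere (cst 0).
Proof.
split=> [x|i x|i j]; rewrite ?partial_cst0; try exact: differentiable_cst.
exact: cst_continuous.
Qed.

Lemma partialD i u w : (forall x, differentiable u x) ->
  (forall x, differentiable w x) ->
  partial i (u \+ w) = partial i u \+ partial i w.
Proof.
by move=> du dw; apply/funext => x; rewrite /partial deriveD //;
  exact: diff_derivable.
Qed.

Lemma partial2D i j u w : C2_everywhere u -> C2_everywhere w ->
  partial j (partial i (u \+ w)) =
  partial j (partial i u) \+ partial j (partial i w).
Proof. by move=> [du dpu _] [dw dpw _]; rewrite !partialD. Qed.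

Lemma C2_add u w : C2_everywhere u -> C2_everywhere w ->
  C2_everywhere (u \+ w).
Proof.
move=> Cu Cw; have [du dpu cu] := Cu; have [dw dpw cw] := Cw.
split=> [x|i x|i j].
- exact: differentiableD.
- by rewrite partialD //; exact: differentiableD.
- by rewrite partial2D // => x; exact: (cvgD (cu i j x) (cw i j x)).
Qed.

Definition rescale c a y u x : R := c * u (a *: (x - y)).

Lemma is_diff_rescale c a y u x : differentiable u (a *: (x - y)) ->
  is_diff x (rescale c a y u)
    (fun v => c * (a * 'd u (a *: (x - y)) v)).
Proof.
move=> du.
have dA : is_diff x (a *: (id - cst y)) (a *: (id - 0)) by exact: is_diffZ.
have du' : is_diff ((a *: (id - cst y)) x) u ('d u (a *: (x - y))).
  exact: DiffDef.
have dc : is_diff x (u \o (a *: (id - cst y))) _ := is_diff_comp dA du'.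
have dcc : is_diff x (c *: (u \o (a *: (id - cst y)))) _ := is_diffZ c dc.
apply: (is_diff_eq dcc).
apply/funext => v /=; rewrite !fctE /=; congr (c * _).
by rewrite subr0 linearZ.
Qed.

Lemma differentiable_rescale c a y u : (forall x, differentiable u x) ->
  forall x, differentiable (rescale c a y u) x.
Proof. by move=> du x; have := is_diff_rescale c (du (a *: (x - y))); case. Qed.

Lemma partial_rescale i c a y u : (forall x, differentiable u x) ->
  partial i (rescale c a y u) = rescale (c * a) a y (partial i u).
Proof.
move=> du; apply/funext => x; have H := is_diff_rescale c (du (a *: (x - y))).
rewrite /partial deriveE; last by case: H.
rewrite (@diff_val _ _ _ _ _ _ _ H) /rescale deriveE //; exact: mulrA.
Qed.

Lemma partial2_rescale i j c a y u : C2_everywhere u ->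
  partial j (partial i (rescale c a y u)) =
  rescale (c * a * a) a y (partial j (partial i u)).
Proof. by move=> [du dpu _]; rewrite !partial_rescale. Qed.

Lemma C2_rescale c a y u : C2_everywhere u -> C2_everywhere (rescale c a y u).
Proof.
move=> Cu; have [du dpu cu] := Cu.
split=> [x|i x|i j].
- exact: differentiable_rescale.
- by rewrite partial_rescale //; exact: differentiable_rescale.
- rewrite partial2_rescale // => x.
  pose A x := a *: (x - y).
  apply: (@continuousM _ _ (cst (c * a * a)) (partial j (partial i u) \o A)).
    exact: cst_continuous.
  apply: continuous_comp; last exact: cu.
  exact: (cvgZl_tmp (cvgB cvg_id (cvg_cst y))).
Qed.

Lemma laplacianD u w x : C2_everywhere u -> C2_everywhere w ->
  laplacian (u \+ w) x = laplacian u x + laplacian w x.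
Proof.
by move=> Cu Cw; rewrite -big_split; apply: eq_bigr => i _; rewrite partial2D.
Qed.

Lemma laplacian_rescale c a y u x : C2_everywhere u ->
  laplacian (rescale c a y u) x = rescale (c * a * a) a y (laplacian u) x.
Proof.
move=> Cu; rewrite /laplacian /rescale mulr_sumr.
by apply: eq_bigr => i _; rewrite partial2_rescale.
Qed.

Lemma laplacian_continuous u : C2_everywhere u -> continuous (laplacian u).
Proof.
move=> [_ _ c2] x; rewrite /laplacian; elim: (index_enum _) => [|i s IH].
  under eq_fun do rewrite big_nil; exact: cst_continuous.
under eq_fun do rewrite big_cons.
by apply: (@continuousD _ _ _ (partial i (partial i u))); first exact: c2.
Qed.

Definition tensor (f : 'I_n -> R -> R) x : R := \prod_i f i (x 0 i).

Lemma differentiable_tensor (f : 'I_n -> R -> R) x :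
  (forall i t, derivable (f i) t 1) -> differentiable (tensor f) x.
Proof.
move=> df; rewrite /tensor; elim: (index_enum _) => [|i s IH].
  under eq_fun do rewrite big_nil; exact: differentiable_cst.
under eq_fun do rewrite big_cons.
apply: (@differentiableM _ _ (fun x => f i (x 0 i))) => //.
apply: (@differentiable_comp _ _ _ _ (fun x : 'rV_n => x 0 i) (f i)).
  exact: differentiable_coord.
exact/derivable1_diffP.
Qed.

Lemma continuous_tensor (f : 'I_n -> R -> R) :
  (forall i, continuous (f i)) -> continuous (tensor f).
Proof.
move=> cf x; rewrite /tensor; elim: (index_enum _) => [|i s IH].
  under eq_fun do rewrite big_nil; exact: cst_continuous.
under eq_fun do rewrite big_cons.
apply: (@continuousM _ _ (fun x => f i (x 0 i))) => //.
apply: (@continuous_comp _ _ _ (fun x : 'rV_n => x 0 i) (f i)).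
  exact: coord_continuous.
exact: cf.
Qed.

Lemma partial_tensor (i : 'I_n) (f : 'I_n -> R -> R) (df : R -> R) :
  (forall t : R, is_derive t 1 (f i) (df t)) ->
  partial i (tensor f) = tensor (fun j => if j == i then df else f j).
Proof.
move=> fi; apply/funext => x; rewrite /partial /derive; apply: cvg_lim => //.
(* P collects the factors that do not depend on the i-th coordinate. *)
pose P := \prod_(j | j != i) f j (x 0 j).
have tE h : tensor f (h *: delta_mx 0 i + x) = f i (h + x 0 i) * P.
  rewrite /tensor (bigD1 i) //= !mxE !eqxx mulr1; congr (_ * _).
  by apply: eq_bigr => j ji; rewrite !mxE (negPf ji) andbF mulr0 add0r.
have -> : (fun h => h^-1 *: ((tensor f \o shift x) (h *: delta_mx 0 i) -
    tensor f x)) =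
    (fun h => (h^-1 *: ((f i \o shift (x 0 i)) (h *: 1) - f i (x 0 i))) * P).
  apply/funext => h /=; rewrite tE.
  have -> : tensor f x = f i (x 0 i) * P.
    by rewrite -(add0r x) -(scale0r (delta_mx 0 i)) tE !mxE mul0r add0r.
  by rewrite [h *: 1]mulr1 -mulrBl scalerAl.
rewrite /tensor (bigD1 i) //= eqxx.
rewrite (eq_bigr (fun j => f j (x 0 j))) => [|j /negPf->//].
apply: cvgMr_tmp; have [d dE] := fi (x 0 i).
by rewrite -dE.
Qed.

End SecondOrder.

(** * A compactly supported function, harmonic near the origin *)

Section Seed.
Context {R : realType} {n : nat} (i0 i1 : 'I_n).
Implicit Types (x : 'rV[R]_n) (m : 'I_n -> nat).

(** For i0 != i1 and entries of m at most 2, this is the derivative of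
    multi-order m of x_i0 * x_i1 times the product of the bumps in all
    coordinates. *)
Definition seedD m : 'rV[R]_n -> R :=
  tensor (fun k => profile ((k == i0) || (k == i1)) (m k)).

Definition seed : 'rV[R]_n -> R := seedD (fun=> 0).

Lemma partial_seedD i m : (m i < 2)%N ->
  partial i (seedD m) = seedD (fun k => m k + (k == i))%N.
Proof.
move=> mi; have H t := @is_derive_profile R ((i == i0) || (i == i1)) _ t mi.
rewrite /seedD (@partial_tensor _ _ i (fun k => profile _ (m k)) _ H).
congr tensor; apply/funext => k; case: eqP => [->|_]; first by rewrite addn1.
by rewrite addn0.
Qed.

Lemma partial_seed i : partial i seed = seedD (fun k => k == i).
Proof. by rewrite partial_seedD. Qed.

Lemma partial2_seed i j :
  partial j (partial i seed) = seedD (fun k => (k == i) + (k == j))%N.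
Proof. by rewrite partial_seed partial_seedD //; case: (j == i). Qed.

Lemma C2_seed : C2_everywhere seed.
Proof.
split=> [x|i x|i j].
- apply: differentiable_tensor => k t.
  by have [] := @is_derive_profile R ((k == i0) || (k == i1)) 0 t isT.
- rewrite partial_seed; apply: differentiable_tensor => k t.
  have kl : ((k == i) < 2)%N by case: (k == i).
  by have [] := @is_derive_profile R ((k == i0) || (k == i1)) _ t kl.
- rewrite partial2_seed; apply: continuous_tensor => k.
  exact: profile_continuous.
Qed.

Lemma seedD_outer m x : 1 <= `|x| -> seedD m x = 0.
Proof.
move=> x1; have [|i xi] := @ex_coord_norm _ _ x; first exact: lt_le_trans x1.
by rewrite /seedD /tensor (bigD1 i) //= profile_outer ?mul0r // -xi.
Qed.

Lemma seedD_bounded : exists2 B : R, 0 <= B & forall m x, `|seedD m x| <= B.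
Proof.
have [B B0 HB] := @profile_bounded R; exists (B ^+ n); first exact: exprn_ge0.
move=> m x; rewrite /seedD /tensor normr_prod.
rewrite -[X in _ ^+ X](card_ord n) -prodr_const.
by apply: ler_prod => i _; rewrite normr_ge0 HB.
Qed.

(** On this cube the seed is affine in each coordinate separately. *)
Lemma laplacian_seed_inner x : `|x| <= 2^-1 -> laplacian seed x = 0.
Proof.
move=> x2; apply: big1 => i _.
rewrite partial2_seed /seedD /tensor (bigD1 i) //= eqxx profile_inner.
  by case: (_ || _); rewrite mul0r.
exact: le_trans (coord_le_norm x i) x2.
Qed.

Lemma partial2_seed0 : i0 != i1 ->
  partial i1 (partial i0 seed) 0 = 1.
Proof.
move=> i01; rewrite partial2_seed /seedD /tensor; apply: big1 => k _.
rewrite mxE profile_inner ?normr0 ?invr_ge0 //.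
have [->|k0] := eqVneq k i0; first by rewrite (negPf i01).
by case: (k == i1).
Qed.

End Seed.

(** * Large mixed derivative, bounded Laplacian *)

Section Stack.
Context {R : realType} {n : nat} (i0 i1 : 'I_n).
Implicit Types (x : 'rV[R]_n).

(** The sum of 16^-l seed(4^l x) over l < m, organised from the largest scale
    inwards: the dilated stack lives where the seed is still harmonic. *)
Fixpoint stack (m : nat) : 'rV[R]_n -> R :=
  if m is m'.+1 then seed i0 i1 \+ rescale 16^-1 4 0 (stack m') else cst 0.

Lemma C2_stack m : C2_everywhere (stack m).
Proof.
elim: m => [|m IH]; first exact: C2_cst0.
by apply: C2_add; [exact: C2_seed|exact: C2_rescale].
Qed.

Lemma partial_stackS i m : partial i (stack m.+1) =
  partial i (seed i0 i1) \+ rescale 4^-1 4 0 (partial i (stack m)).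
Proof.
have [ds _ _] := @C2_seed R n i0 i1; have [dw _ _] := C2_stack m.
rewrite partialD //; last exact: differentiable_rescale.
by rewrite partial_rescale //; congr (_ \+ rescale _ _ _ _); lra.
Qed.

Lemma partial2_stackS i j m : partial j (partial i (stack m.+1)) =
  partial j (partial i (seed i0 i1)) \+
  rescale 1 4 0 (partial j (partial i (stack m))).
Proof.
rewrite partial2D; [|exact: C2_seed|exact/C2_rescale/C2_stack].
rewrite partial2_rescale; last exact: C2_stack.
by congr (_ \+ rescale _ _ _ _); lra.
Qed.

Lemma laplacian_stackS m x : laplacian (stack m.+1) x =
  laplacian (seed i0 i1) x + rescale 1 4 0 (laplacian (stack m)) x.
Proof.
rewrite laplacianD; [|exact: C2_seed|exact/C2_rescale/C2_stack].
rewrite laplacian_rescale; last exact: C2_stack.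
by congr (_ + rescale _ _ _ _ _); lra.
Qed.

Lemma norm_zoom x : `|4 *: (x - 0)| = 4 * `|x|.
Proof. by rewrite subr0 normrZ gtr0_norm. Qed.

(** Shared induction for a stack and its derivatives, which all satisfy the
    recursion of F, with c = 1/16, 1/4, 1 for the orders 0, 1, 2. *)
Lemma stacking (F : nat -> 'rV[R]_n -> R) (s : 'rV[R]_n -> R) (c B : R) :
  0 <= c <= 1 -> F 0 = cst 0 -> (forall m, F m.+1 = s \+ rescale c 4 0 (F m)) ->
  (forall x, `|s x| <= B) -> (forall x, 1 <= `|x| -> s x = 0) ->
  forall m x, `|F m x| <= B * m%:R /\ (1 <= `|x| -> F m x = 0).
Proof.
move=> /andP[c0 c1] F0 FS sB s0; elim=> [|m IH] x.
  by rewrite F0 /= normr0 mulr0.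
rewrite FS /= /rescale; split=> [|x1]; last first.
  rewrite s0 // (IH _).2 ?mulr0 ?addr0 // norm_zoom.
  by apply: le_trans x1 _; rewrite ler_peMl // ler1n.
rewrite -[m.+1%:R]natr1 mulrDr mulr1 addrC (le_trans (ler_normD _ _)) // lerD //.
rewrite normrM ger0_norm //; apply: le_trans (IH (4 *: (x - 0))).1.
by rewrite ler_piMl.
Qed.

Lemma stack_jets (B : R) : (forall m x, `|seedD i0 i1 m x| <= B) -> forall m x,
  [/\ `|stack m x| <= B * m%:R /\ (1 <= `|x| -> stack m x = 0),
      forall i, `|partial i (stack m) x| <= B * m%:R /\
        (1 <= `|x| -> partial i (stack m) x = 0)
    & forall i j, `|partial j (partial i (stack m)) x| <= B * m%:R /\
        (1 <= `|x| -> partial j (partial i (stack m)) x = 0)].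
Proof.
move=> sB m x; split=> [|i|i j].
- apply: (@stacking stack (seed i0 i1) 16^-1) => //.
  + by apply/andP; split; lra.
  + by move=> y; exact: sB.
  + by move=> y; exact: seedD_outer.
- apply: (@stacking (fun m => partial i (stack m)) (partial i (seed i0 i1)) 4^-1).
  + by apply/andP; split; lra.
  + exact: partial_cst0.
  + by move=> k; exact: partial_stackS.
  + by move=> y; rewrite partial_seed; exact: sB.
  + by move=> y; rewrite partial_seed; exact: seedD_outer.
- apply: (@stacking (fun m => partial j (partial i (stack m)))
    (partial j (partial i (seed i0 i1))) 1).
  + by rewrite ler01 lexx.
  + by rewrite !partial_cst0.
  + by move=> k; exact: partial2_stackS.
  + by move=> y; rewrite partial2_seed; exact: sB.
  + by move=> y; rewrite partial2_seed; exact: seedD_outer.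
Qed.

Lemma stack_outer m x : 1 <= `|x| ->
  [/\ stack m x = 0, forall i, partial i (stack m) x = 0
    & forall i j, partial j (partial i (stack m)) x = 0].
Proof.
have [B _ sB] := @seedD_bounded R n i0 i1 => x1.
have [s0 s1 s2] := stack_jets sB m x.
by split=> [|i|i j]; [apply: s0.2|apply: (s1 i).2|apply: (s2 i j).2].
Qed.

Lemma stack_bounds : exists2 B : R, 0 <= B & forall m x,
  [/\ `|stack m x| <= B * m%:R,
      forall i, `|partial i (stack m) x| <= B * m%:R
    & forall i j, `|partial j (partial i (stack m)) x| <= B * m%:R].
Proof.
have [B B0 sB] := @seedD_bounded R n i0 i1; exists B => // m x.
have [s0 s1 s2] := stack_jets sB m x.
by split=> [|i|i j]; [apply: s0.1|apply: (s1 i).1|apply: (s2 i j).1].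
Qed.

(** No growth with m: for |x| <= 1/2 the outermost seed is harmonic, and for
    |x| > 1/2 the inner stack, dilated by 4, vanishes. So at each point at most
    one scale contributes. *)
Lemma laplacian_stack_bounded : exists2 B : R, 0 <= B & forall m x,
  `|laplacian (stack m) x| <= B.
Proof.
have [B B0 sB] := @seedD_bounded R n i0 i1.
exists (B *+ n) => [|m x]; first exact: mulrn_wge0.
elim: m x => [|m IH] x.
  by rewrite /laplacian big1 ?normr0 ?mulrn_wge0 // => i _; rewrite !partial_cst0.
rewrite laplacian_stackS /rescale mul1r.
have [x2|x2] := leP `|x| 2^-1; first by rewrite laplacian_seed_inner // add0r.
rewrite [X in _ + X]big1 ?addr0 => [|i _]; last first.
  have [|_ _ ->] := @stack_outer m (4 *: (x - 0)) => //.
  by rewrite norm_zoom; move: x2; lra.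
rewrite (le_trans (ler_norm_sum _ _ _)) // -[in leRHS](card_ord n).
by rewrite -sumr_const; apply: ler_sum => i _; rewrite partial2_seed.
Qed.

(** Dilation by 4 and division by 16 preserve second derivatives at 0, so each
    scale contributes 1. *)
Lemma partial2_stack0 m : i0 != i1 ->
  partial i1 (partial i0 (stack m)) 0 = m%:R.
Proof.
move=> i01; elim: m => [|m IH]; first by rewrite !partial_cst0.
by rewrite partial2_stackS /= /rescale subr0 scaler0 IH partial2_seed0 // mul1r mulrS.
Qed.

End Stack.

(** * Disjoint rescaled stacks accumulating at the origin *)

Section Patches.
Context {R : realType} {n : nat} (i0 i1 : 'I_n).
Implicit Types (x z : 'rV[R]_n) (k l N : nat).

Definition gap k : R := 2^-1 ^+ k.
Definition centre k : 'rV[R]_n := gap k *: delta_mx 0 i0.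
(** Quadratic in the distance to the origin, so that a function of this size
    on the k-th cube is O(|x|^2). *)
Definition radius k : R := gap k ^+ 2 / 4.

Lemma gap_gt0 k : 0 < gap k.
Proof. by rewrite exprn_gt0. Qed.

Lemma gap_le1 k : gap k <= 1.
Proof. by rewrite exprn_ile1 //; lra. Qed.

Lemma gapS k : gap k.+1 = gap k / 2.
Proof. by rewrite /gap exprSr. Qed.

Lemma gap_le k l : (k <= l)%N -> gap l <= gap k.
Proof. by move=> kl; rewrite ler_wiXn2l //; lra. Qed.

Lemma gap_small (e : R) : 0 < e -> exists k, gap k < e.
Proof.
move=> e0; exists (Num.truncn e^-1).
rewrite /gap exprVn -[ltRHS]invrK ltf_pV2 ?posrE ?exprn_gt0 ?invr_gt0 //.
by apply: lt_le_trans (truncnS_gt e^-1) _; rewrite -natrX ler_nat ltn_expl.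
Qed.

Lemma radius_gt0 k : 0 < radius k.
Proof. by rewrite divr_gt0 // exprn_gt0 // gap_gt0. Qed.

Lemma radius_le k : radius k <= gap k / 4.
Proof.
by rewrite /radius; have := gap_gt0 k; have := gap_le1 k; nra.
Qed.

Lemma norm_centre k : `|centre k| = gap k.
Proof.
have d1 : `|delta_mx 0 i0 : 'rV[R]_n| = 1.
  apply/eqP; rewrite eq_le; apply/andP; split.
    rewrite [leLHS]/Num.Def.normr /= mx_normrE.
    apply: bigmax_le => // -[i j] _ /=.
    by rewrite mxE; case: (_ && _); rewrite ?normr1 ?normr0.
  by have := coord_le_norm (delta_mx 0 i0 : 'rV[R]_n) i0; rewrite mxE !eqxx normr1.
by rewrite /centre normrZ d1 mulr1 gtr0_norm // gap_gt0.
Qed.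

(** The factor radius^2 makes the rescaling invariant for second derivatives.
    With 2^k scales divided by 2^k (the factor [gap k]), the mixed derivative
    at the centre is 1, while the Laplacian is at most of order 2^-k, hence
    O(|x|) on the k-th cube. *)
Definition patch k : 'rV[R]_n -> R :=
  rescale (radius k ^+ 2 * gap k) (radius k)^-1 (centre k)
    (stack i0 i1 (2 ^ k)).

Lemma C2_patch k : C2_everywhere (patch k).
Proof. exact/C2_rescale/C2_stack. Qed.

Lemma partial_patch i k : partial i (patch k) =
  rescale (radius k * gap k) (radius k)^-1 (centre k)
    (partial i (stack i0 i1 (2 ^ k))).
Proof.
have [ds _ _] := @C2_stack R n i0 i1 (2 ^ k); rewrite partial_rescale //.
congr rescale; have := lt0r_neq0 (radius_gt0 k); move: (radius k) => r r0.
by field.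
Qed.

Lemma partial2_patch i j k : partial j (partial i (patch k)) =
  rescale (gap k) (radius k)^-1 (centre k)
    (partial j (partial i (stack i0 i1 (2 ^ k)))).
Proof.
rewrite partial2_rescale; last exact: C2_stack.
congr rescale; have := lt0r_neq0 (radius_gt0 k); move: (radius k) => r r0.
by field.
Qed.

Lemma laplacian_patch k x : laplacian (patch k) x =
  rescale (gap k) (radius k)^-1 (centre k) (laplacian (stack i0 i1 (2 ^ k))) x.
Proof.
rewrite /laplacian /rescale mulr_sumr.
by apply: eq_bigr => i _; rewrite partial2_patch.
Qed.

Lemma patch_outer k x : radius k <= `|x - centre k| ->
  [/\ patch k x = 0, forall i, partial i (patch k) x = 0
    & forall i j, partial j (partial i (patch k)) x = 0].
Proof.
move=> xk; have := @stack_outer R n i0 i1 (2 ^ k) ((radius k)^-1 *: (x - centre k)).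
case=> [|s0 s1 s2].
  rewrite normrZ normfV gtr0_norm ?radius_gt0 //.
  by rewrite ler_pdivlMl ?radius_gt0 // mulr1.
split=> [|i|i j].
- by rewrite /patch /rescale s0 mulr0.
- by rewrite partial_patch /rescale s1 mulr0.
- by rewrite partial2_patch /rescale s2 mulr0.
Qed.

Lemma laplacian_patch_outer k x : radius k <= `|x - centre k| ->
  laplacian (patch k) x = 0.
Proof. by case/patch_outer => _ _ p2; apply: big1 => i _; exact: p2. Qed.

Lemma gap_mul2X k : gap k * (2 ^ k)%:R = 1.
Proof. by rewrite natrX /gap -exprMn mulVf ?expr1n. Qed.

Lemma patch_far k x : 2 * gap k <= `|x| -> radius k <= `|x - centre k|.
Proof.
move=> xk; apply: le_trans (lerB_dist _ _); rewrite norm_centre.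
by have := radius_le k; have := gap_gt0 k; lra.
Qed.

Lemma patch_near k x : `|x - centre k| < radius k ->
  gap k <= 2 * `|x| /\ radius k <= `|x| ^+ 2.
Proof.
move=> xk; have g0 := gap_gt0 k; have r1 := radius_le k.
have : gap k - `|x| < radius k.
  by apply: le_lt_trans xk; rewrite distrC -[X in X - _](norm_centre k) lerB_dist.
move=> h; split; first by lra.
rewrite /radius; have : gap k / 2 <= `|x| by lra.
by nra.
Qed.

(** The i0-th coordinates on the k-th cube lie within 2^-k / 4 of 2^-k. *)
Lemma patch_disjoint k l x : `|x - centre k| < radius k ->
  `|x - centre l| < radius l -> k = l.
Proof.
have c j : `|x - centre j| < radius j -> `|x 0 i0 - gap j| < gap j / 4.
  move=> xj; apply: lt_le_trans (radius_le j); apply: le_lt_trans xj.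
  by have := coord_le_norm (x - centre j) i0; rewrite !mxE !eqxx mulr1.
have aux a b : (a < b)%N -> `|x - centre a| < radius a ->
    `|x - centre b| < radius b -> False.
  move=> ab /c + /c; have := gap_le ab; rewrite gapS.
  by rewrite !ltr_norml => ? /andP[? ?] /andP[? ?]; have := gap_gt0 a; lra.
move=> xk xl; have [kl|lk|//] := ltngtP k l.
  by case: (aux _ _ kl).
by case: (aux _ _ lk).
Qed.

(** Since the cubes are disjoint, at most one term of the sum is nonzero. *)
Lemma sum_patch_le (F : nat -> R) N x (E : R) : 0 <= E ->
  (forall k, radius k <= `|x - centre k| -> F k = 0) ->
  (forall k, `|x - centre k| < radius k -> `|F k| <= E) ->
  `|\sum_(k < N) F k| <= E.
Proof.
move=> E0 Fout Fin.
have [[k xk]|no] := pselect (exists k : 'I_N, `|x - centre k| < radius k).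
  rewrite (bigD1 k) //= big1 ?addr0 ?Fin // => l lk.
  have [/Fout //|xl] := leP (radius l) `|x - centre l|.
  by case/eqP: lk; apply: val_inj; rewrite /= (patch_disjoint xl xk).
rewrite big1 ?normr0 // => k _; apply: Fout; rewrite leNgt; apply/negP => xk.
by apply: no; exists k.
Qed.

Fixpoint patch_sum N : 'rV[R]_n -> R :=
  if N is N'.+1 then patch_sum N' \+ patch N' else cst 0.

Lemma C2_patch_sum N : C2_everywhere (patch_sum N).
Proof.
elim: N => [|N IH]; first exact: C2_cst0.
exact/C2_add/C2_patch.
Qed.

Lemma patch_sumE N x : patch_sum N x = \sum_(k < N) patch k x.
Proof. by elim: N => [|N IH]; rewrite ?big_ord0 // big_ord_recr /= IH. Qed.

Lemma partial_patch_sumE i N x : partial i (patch_sum N) x =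
  \sum_(k < N) partial i (patch k) x.
Proof.
elim: N => [|N IH]; first by rewrite big_ord0 partial_cst0.
have [dS _ _] := C2_patch_sum N; have [dP _ _] := C2_patch N.
rewrite big_ord_recr -IH.
exact: (congr1 (fun f => f x) (partialD i dS dP)).
Qed.

Lemma partial2_patch_sumE i j N x : partial j (partial i (patch_sum N)) x =
  \sum_(k < N) partial j (partial i (patch k)) x.
Proof.
elim: N => [|N IH]; first by rewrite big_ord0 !partial_cst0.
rewrite big_ord_recr -IH.
exact: (congr1 (fun f => f x) (partial2D i j (C2_patch_sum N) (C2_patch N))).
Qed.

Lemma laplacian_patch_sumE N x : laplacian (patch_sum N) x =
  \sum_(k < N) laplacian (patch k) x.
Proof.
by rewrite exchange_big; apply: eq_bigr => i _; exact: partial2_patch_sumE.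
Qed.

(** The decay comes from the position of the cubes: radius <= |x|^2 and
    gap <= 2 |x| on each of them. *)
Lemma patch_sum_bounds : exists2 K : R, 0 <= K & forall N x,
  [/\ `|patch_sum N x| <= K * `|x| ^+ 2,
      forall i, `|partial i (patch_sum N) x| <= K * `|x| ^+ 2,
      forall i j, `|partial j (partial i (patch_sum N)) x| <= K
    & `|laplacian (patch_sum N) x| <= K * `|x|].
Proof.
have [B B0 sB] := @stack_bounds R n i0 i1.
have [L L0 sL] := @laplacian_stack_bounded R n i0 i1.
have K0 : 0 <= B + 2 * L by lra.
exists (B + 2 * L) => // N x; have x0 := normr_ge0 x.
pose X k := (radius k)^-1 *: (x - centre k).
have sbound k (s a : R) : 0 <= a -> `|s| <= B * (2 ^ k)%:R ->
    `|a * gap k * s| <= B * a.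
  move=> a0 sb; rewrite -mulrA normrM ger0_norm // mulrC ler_wpM2r //.
  rewrite normrM gtr0_norm ?gap_gt0 // -[leRHS]mul1r -(gap_mul2X k) -mulrA.
  by rewrite ler_pM2l ?gap_gt0 // mulrC.
have KB (a : R) : 0 <= a -> B * a <= (B + 2 * L) * a by move=> a0; nra.
split=> [|i|i j|].
- rewrite patch_sumE.
  apply: (@sum_patch_le (fun k => patch k x) N x) => [|k /patch_outer[]//|k xk].
    by rewrite mulr_ge0 // exprn_ge0.
  have [_ rx] := patch_near xk; have [s0 _ _] := sB (2 ^ k)%N (X k).
  have r0 := radius_gt0 k; have r1 := radius_le k; have g1 := gap_le1 k.
  apply: le_trans (sbound k _ (radius k ^+ 2) _ s0) _.
    by rewrite exprn_ge0 // ltW.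
  apply: le_trans (KB _ _) _; first by rewrite exprn_ge0 // ltW.
  by rewrite ler_wpM2l //; nra.
- rewrite partial_patch_sumE.
  apply: (@sum_patch_le (fun k => partial i (patch k) x) N x)
    => [|k /patch_outer[_ ->]//|k xk].
    by rewrite mulr_ge0 // exprn_ge0.
  have [_ rx] := patch_near xk; have [_ s1 _] := sB (2 ^ k)%N (X k).
  have r0 := ltW (radius_gt0 k); rewrite partial_patch.
  apply: le_trans (sbound k _ _ r0 (s1 i)) _.
  by apply: le_trans (KB _ r0) _; rewrite ler_wpM2l.
- rewrite partial2_patch_sumE.
  apply: (@sum_patch_le (fun k => partial j (partial i (patch k)) x) N x)
    => [//|k /patch_outer[_ _ ->]//|k xk].
  have [_ _ s2] := sB (2 ^ k)%N (X k); rewrite partial2_patch.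
  have := sbound k _ _ ler01 (s2 i j); rewrite mul1r mulr1 => /le_trans; apply.
  by lra.
- rewrite laplacian_patch_sumE.
  apply: (@sum_patch_le (fun k => laplacian (patch k) x) N x)
    => [|k /laplacian_patch_outer//|k xk].
    by rewrite mulr_ge0.
  have [gx _] := patch_near xk; rewrite laplacian_patch /rescale.
  rewrite normrM gtr0_norm ?gap_gt0 //.
  have := sL (2 ^ k)%N (X k); rewrite -/(X k).
  have := normr_ge0 (laplacian (stack i0 i1 (2 ^ k)) (X k)).
  move: (`|laplacian _ _|) => l l0 lL; have := gap_gt0 k => g0.
  apply: (@le_trans _ _ (2 * `|x| * L)); first by rewrite ler_pM // ltW.
  by nra.
Qed.

End Patches.

(** * The sum of all patches *)

Section Limit.
Context {R : realType} {n : nat} (i0 i1 : 'I_n).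
Implicit Types (x z : 'rV[R]_n) (k N : nat).

(** At every point the sequence is eventually constant: away from the origin
    because only finitely many cubes meet the complement of a neighbourhood of
    the origin, and at the origin because no cube contains it. *)
Definition patch_series x : R := limn (fun N => patch_sum i0 i1 N x).

Lemma patch_seriesE N x : 2 * gap N <= `|x| ->
  patch_series x = patch_sum i0 i1 N x.
Proof.
move=> xN; apply: lim_near_cst => //; near=> M.
have NM : (N <= M)%N by near: M; exact: nbhs_infty_ge.
rewrite -(subnKC NM); elim: (M - N)%N => [|d IH]; first by rewrite addn0.
rewrite addnS /= IH; have [|-> _ _] := @patch_outer R n i0 i1 (N + d) x.
  apply: patch_far; apply: le_trans xN.
  by rewrite ler_pM2l // gap_le // leq_addr.
by rewrite addr0.
Unshelve. all: by end_near. Qed.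

Lemma patch_series0 : patch_series 0 = 0.
Proof.
apply: lim_near_cst => //; apply: nearW => N; rewrite patch_sumE big1 // => k _.
have [|-> //] := @patch_outer R n i0 i1 k 0.
rewrite sub0r normrN norm_centre.
by have := @radius_le R k; have := @gap_gt0 R k; lra.
Qed.

Lemma near_gap N x : 2 * gap N < `|x| -> \forall z \near x, 2 * gap N < `|z|.
Proof. by have /cvgr_gt := @norm_continuous _ _ x; apply. Qed.

Lemma near_patch_series N x : 2 * gap N < `|x| ->
  {near x, patch_sum i0 i1 N =1 patch_series}.
Proof.
by move=> /near_gap; apply: filterS => z zN; rewrite (patch_seriesE (ltW zN)).
Qed.

Lemma partial_patch_seriesE i N x : 2 * gap N < `|x| ->
  partial i patch_series x = partial i (patch_sum i0 i1 N) x.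
Proof. by move=> /near_patch_series xN; apply/esym/near_eq_derive. Qed.

Lemma near_partial_patch_series i N x : 2 * gap N < `|x| ->
  {near x, partial i (patch_sum i0 i1 N) =1 partial i patch_series}.
Proof.
by move=> /near_gap; apply: filterS => z zN; rewrite (partial_patch_seriesE _ zN).
Qed.

Lemma partial2_patch_seriesE i j N x : 2 * gap N < `|x| ->
  partial j (partial i patch_series) x = partial j (partial i (patch_sum i0 i1 N)) x.
Proof. by move=> /(near_partial_patch_series i) xN; apply/esym/near_eq_derive. Qed.

Lemma laplacian_patch_seriesE N x : 2 * gap N < `|x| ->
  laplacian patch_series x = laplacian (patch_sum i0 i1 N) x.
Proof. by move=> xN; apply: eq_bigr => i _; exact: partial2_patch_seriesE. Qed.

Lemma near_laplacian_patch_series N x : 2 * gap N < `|x| ->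
  {near x, laplacian (patch_sum i0 i1 N) =1 laplacian patch_series}.
Proof.
by move=> /near_gap; apply: filterS => z zN; rewrite (laplacian_patch_seriesE zN).
Qed.

Lemma ex_gap x : x != 0 -> exists N, 2 * gap N < `|x|.
Proof.
move=> x0; have [|N HN] := @gap_small R (`|x| / 2).
  by rewrite divr_gt0 // normr_gt0.
by exists N; lra.
Qed.

Lemma partial0_quadratic i (f : 'rV[R]_n -> R) (K : R) : f 0 = 0 ->
  (forall x, `|f x| <= K * `|x| ^+ 2) -> partial i f 0 = 0.
Proof.
move=> f0 fK; have H := is_diff0_quadratic f0 fK.
rewrite /partial deriveE; last by case: H.
by rewrite (@diff_val _ _ _ _ _ _ _ H).
Qed.

(** The bounds at the origin follow in order: the quadratic bound on a function
    kills its partial derivatives at 0, which extends the quadratic bound on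
    these to 0, which in turn kills the second derivatives at 0. *)
Lemma patch_series_bounds : exists2 K : R, 0 <= K & forall x,
  [/\ `|patch_series x| <= K * `|x| ^+ 2,
      forall i, `|partial i patch_series x| <= K * `|x| ^+ 2,
      forall i j, `|partial j (partial i patch_series) x| <= K
    & `|laplacian patch_series x| <= K * `|x|].
Proof.
have [K K0 pK] := @patch_sum_bounds R n i0 i1; exists K => // x.
have away z : z != 0 -> [/\ `|patch_series z| <= K * `|z| ^+ 2,
      forall i, `|partial i patch_series z| <= K * `|z| ^+ 2,
      forall i j, `|partial j (partial i patch_series) z| <= K
    & `|laplacian patch_series z| <= K * `|z|].
  move=> /ex_gap[N zN]; have [p0 p1 p2 pl] := pK N z.
  split=> [|i|i j|].
  - by rewrite (patch_seriesE (ltW zN)).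
  - by rewrite (partial_patch_seriesE _ zN).
  - by rewrite (partial2_patch_seriesE _ _ zN).
  - by rewrite (laplacian_patch_seriesE zN).
have [->|/away//] := eqVneq x 0.
have h0 z : `|patch_series z| <= K * `|z| ^+ 2.
  have [->|/away[]//] := eqVneq z 0.
  by rewrite patch_series0 !normr0 expr0n mulr0.
have ph0 i : partial i patch_series 0 = 0.
  exact: partial0_quadratic patch_series0 h0.
have h1 i z : `|partial i patch_series z| <= K * `|z| ^+ 2.
  have [->|/away[]//] := eqVneq z 0.
  by rewrite ph0 !normr0 expr0n mulr0.
have pph0 i j : partial j (partial i patch_series) 0 = 0.
  exact: partial0_quadratic (ph0 i) (h1 i).
split=> // [i j|]; first by rewrite pph0 normr0.
by rewrite /laplacian big1 ?normr0 ?mulr0.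
Qed.

Lemma patch_series_vanish0 : (forall i, partial i patch_series 0 = 0) /\
  (forall i j, partial j (partial i patch_series) 0 = 0).
Proof.
have [K K0 hK] := patch_series_bounds.
have h1 i : partial i patch_series 0 = 0.
  by apply: (@partial0_quadratic _ _ K patch_series0) => x; have [] := hK x.
by split=> // i j; apply: (@partial0_quadratic _ _ K (h1 i)) => x; have [] := hK x.
Qed.

Lemma compactly_supported_patch_series : compactly_supported patch_series.
Proof.
have sub : [set x | patch_series x != 0] `<=` [set x | `|x| <= 2].
  move=> x /= x0; rewrite leNgt; apply/negP => x2; case/eqP: x0.
  by rewrite (@patch_seriesE 0) //= /gap expr0 mulr1 ltW.
have cl : closed [set x : 'rV[R]_n | `|x| <= 2].
  apply: (@preimage_closed _ _ (fun x : 'rV[R]_n => `|x|) [set r : R | r <= 2]).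
    by move=> x _; exact: norm_continuous.
  exact: closed_le.
apply: bounded_closed_compact; last exact: closed_closure.
exists 2; split=> // M M2 x /(closure_subset sub); rewrite -(closure_id _).1 //= => x2.
by apply: le_trans x2 (ltW M2).
Qed.

Lemma differentiable_patch_series x : differentiable patch_series x.
Proof.
have [->|/ex_gap[N xN]] := eqVneq x 0.
  have [K K0 hK] := patch_series_bounds.
  have h0 z : `|patch_series z| <= K * `|z| ^+ 2 by have [] := hK z.
  by case: (is_diff0_quadratic patch_series0 h0).
by apply: near_eq_differentiable (near_patch_series xN) _;
  have [] := @C2_patch_sum R n i0 i1 N.
Qed.

Lemma differentiable_partial_patch_series i x :
  differentiable (partial i patch_series) x.
Proof.
have [->|/ex_gap[N xN]] := eqVneq x 0.
  have [K K0 hK] := patch_series_bounds.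
  have h1 z : `|partial i patch_series z| <= K * `|z| ^+ 2 by have [] := hK z.
  by case: (is_diff0_quadratic (patch_series_vanish0.1 i) h1).
by apply: near_eq_differentiable (near_partial_patch_series i xN) _;
  have [] := @C2_patch_sum R n i0 i1 N.
Qed.

(** The gradient is a sum of scalar functions times fixed vectors, so it
    inherits differentiability from its components. *)
Lemma twice_differentiable_patch_series : twice_differentiable patch_series.
Proof.
split=> x; first exact: differentiable_patch_series.
have -> : gradient patch_series =
    \sum_i (fun z : 'rV[R]_n => partial i patch_series z *: (delta_mx 0 i : 'rV[R]_n)).
  apply/funext => z; rewrite fct_sumE /gradient; apply/rowP => j.
  rewrite mxE summxE (bigD1 j) //= !mxE !eqxx mulr1 big1 ?addr0 // => i ij.
  by rewrite !mxE eq_sym (negPf ij) andbF mulr0.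
apply: differentiable_sum => i; apply: differentiableZl.
exact: differentiable_partial_patch_series.
Qed.

Lemma continuous_laplacian_patch_series : continuous (laplacian patch_series).
Proof.
move=> x; have [->|/ex_gap[N xN]] := eqVneq x 0.
  have [K K0 hK] := patch_series_bounds.
  have l0 : laplacian patch_series 0 = 0 by apply: big1 => i _; exact: patch_series_vanish0.2.
  by apply: (continuous0_linear l0 (K := K)) => z; have [] := hK z.
apply: near_eq_continuous (near_laplacian_patch_series xN) _.
exact/laplacian_continuous/C2_patch_sum.
Qed.

Lemma bounded_hessian_patch_series : bounded_hessian patch_series.
Proof.
have [K K0 hK] := patch_series_bounds => i j.
exists K; split=> [|M KM x _]; first exact: num_real.
rewrite /= /hessian mxE.
by have [_ _ h2 _] := hK x; apply: le_trans (h2 i j) (ltW KM).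
Qed.

Lemma partial2_patch_series_centre k : i0 != i1 ->
  partial i1 (partial i0 patch_series) (centre i0 k) = 1.
Proof.
move=> i01; have g0 := @gap_gt0 R k.
(* Two more terms make the finite sum exact near the k-th centre. *)
have far : 2 * gap k.+2 < `|centre i0 k : 'rV[R]_n|.
  by rewrite norm_centre !gapS; lra.
have cr : `|centre i0 k - centre i0 k : 'rV[R]_n| < radius k.
  by rewrite subrr normr0 radius_gt0.
rewrite (partial2_patch_seriesE _ _ far) partial2_patch_sumE.
have kk : (k < k.+2)%N by [].
rewrite (bigD1 (Ordinal kk)) //= big1 ?addr0 => [|l lk].
  rewrite partial2_patch /rescale subrr scaler0 partial2_stack0 //.
  exact: gap_mul2X.
have [xl|xl] := leP (radius l) `|centre i0 k - centre i0 l : 'rV[R]_n|.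
  by have [_ _ ->] := @patch_outer R n i0 i1 l _ xl.
by case/eqP: lk; apply: val_inj; rewrite /= (patch_disjoint xl cr).
Qed.

Lemma not_class_C2_patch_series : i0 != i1 -> ~ class_C 2 patch_series.
Proof.
move=> i01 [_ /(_ i0)[_ [_ /(_ i1)[_ [c2 _]]]]].
have := c2 0; rewrite /continuous_at patch_series_vanish0.2 => /cvgr0Pnorm_lt.
move=> /(_ 1 ltr01) /nbhs_normP[e e0 He].
have [k ke] := gap_small e0.
have := He (centre i0 k); rewrite /= sub0r normrN norm_centre => /(_ ke).
by rewrite partial2_patch_series_centre // normr1 ltxx.
Qed.

End Limit.

Theorem theorem1p2 (R : realType) (n : nat) (hn : (2 <= n)%N)
  (phi : R -> R) (phiC2 : class_C2_pos phi)
  (phi_lim : phi s @[s --> +oo] --> +oo)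
  (dphi_lim : phi^`() s @[s --> +oo] --> (0 : R))
  (d2phi_lim : phi^`(2) s @[s --> +oo] --> (0 : R)) :
  exists u : 'rV[R]_n -> R,
    [/\ compactly_supported u,
        twice_differentiable u,
        continuous (laplacian u),
        bounded_hessian u
      & ~ class_C 2 u].
Proof.
have i01 : Ordinal (ltnW hn) != Ordinal hn by [].
exists (patch_series (Ordinal (ltnW hn)) (Ordinal hn)); split.
- exact: compactly_supported_patch_series.
- exact: twice_differentiable_patch_series.
- exact: continuous_laplacian_patch_series.
- exact: bounded_hessian_patch_series.
- exact: not_class_C2_patch_series.
Qed.
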